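(* Let $(P_n(x))_{n\in\mathbb{N}_0}\subseteq\mathbb{R}[x]$ be a sequence given by $P_0(x)=1$, $P_1(x)=x$, $xP_n(x)=a_nP_{n+1}(x)+c_nP_{n-1}(x)$ $(n\in\mathbb{N})$ with $(c_n)_{n\in\mathbb{N}}\subseteq(0,1)$ and $a_n=1-c_n$, and assume that $(P_n(x))_{n\in\mathbb{N}_0}$ satisfies nonnegative linearization of products. Let $\mu$ be the orthogonalization probability measure of $(P_n(x))_{n\in\mathbb{N}_0}$. If $\mu\in M(0,b)$ for some $b\in(0,1]$, then $h(n)\geq 2$ for all $n\in\mathbb{N}$.
   Context: $\mathbb{N}=\{1,2,3,\ldots\}$ and $\mathbb{N}_0=\mathbb{N}\cup\{0\}$. A sequence $(P_n(x))_{n\in\mathbb{N}_0}$ given by such a recurrence satisfies $\deg P_n=n$ and $P_n(1)=1$ for all $n$, and it is orthogonal with respect to a unique probability Borel measure $\mu$ on $\mathbb{R}$ (the orthogonalization measure), meaning that $\int_{\mathbb{R}}P_m(x)P_n(x)\,\mathrm{d}\mu(x)\neq 0\Leftrightarrow m=n$. Nonnegative linearization of products means that in the (unique) expansions $P_m(x)P_n(x)=\sum_{k=0}^{m+n}g(m,n;k)P_k(x)$ all coefficients $g(m,n;k)$ $(m,n,k\in\mathbb{N}_0)$ are nonnegative. The Haar function is $h(n):=1/g(n,n;0)=1/\int_{\mathbb{R}}P_n^2(x)\,\mathrm{d}\mu(x)$; equivalently, $h(0)=1$ and $h(n)=\prod_{k=1}^n a_{k-1}/c_k$ for $n\in\mathbb{N}$,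 where $a_0:=1$. The orthonormal polynomials $p_n(x)=\sqrt{h(n)}P_n(x)$ satisfy $p_0(x)=1$, $p_1(x)=x/\sqrt{c_1}$, $xp_n(x)=\alpha_{n+1}p_{n+1}(x)+\alpha_np_{n-1}(x)$ $(n\in\mathbb{N})$ with $\alpha_n=\sqrt{c_na_{n-1}}$ $(n\in\mathbb{N})$. For $b\in(0,1]$, one says $\mu\in M(0,b)$ (Nevai class) if $\lim_{n\to\infty}\alpha_n=b/2$. *)

(* Defs.v *)
From HB Require Import structures.
From mathcomp Require Import all_boot all_order all_algebra.
From mathcomp Require Import all_classical all_reals all_analysis.

Set Implicit Arguments.
Unset Strict Implicit.
Unset Printing Implicit Defensive.

Import Order.TTheory GRing.Theory Num.Theory.
Import numFieldNormedType.Exports.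

Local Open Scope classical_set_scope.
Local Open Scope ring_scope.

Section Defs.
Variable R : realType.
Implicit Types (c : nat -> R) (P : nat -> {poly R}) (g : nat -> nat -> nat -> R).

(* The value c 0 is never used: a_0 is 1 by convention. *)
Definition acoef c (n : nat) : R := if n == 0%N then 1 else 1 - c n.

Definition three_term_recurrence c P : Prop :=
  [/\ P 0%N = 1, P 1%N = 'X
    & forall n, (0 < n)%N ->
        'X * P n = acoef c n *: P n.+1 + c n *: P n.-1].

(* Such a g exists and is unique: the last clause fixes the coefficients that
   the expansion leaves free (linearization_coefs_exist and
   linearization_coefs_unique below). *)
Definition linearization_coefs P g : Prop :=
  forall m n, P m * P n = \sum_(k < (m + n).+1) g m n k *: P k
    /\ forall k, (m + n < k)%N -> g m n k = 0.

Definition nonneg_linearization g : Prop := forall m n k, 0 <= g m n k.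

(* 1 / g n n 0 is also the inverse of the squared norm of P n, by
   haar_integral below. *)
Definition haar g (n : nat) : R := (g n n 0%N)^-1.

(* Integrability is explicit because \int is total. *)
Definition orthogonalization_measure P
    (mu : probability (measurableTypeR R) R) : Prop :=
  forall m n,
    mu.-integrable [set: measurableTypeR R] (fun x => ((P m).[x] * (P n).[x])%:E)
    /\ ((\int[mu]_x ((P m).[x] * (P n).[x])%:E)%E != 0%E <-> m = n).

(* Only used for n >= 1. *)
Definition alpha c (n : nat) : R := Num.sqrt (c n * acoef c n.-1).

(* The class M(0,b), for the measure whose recurrence coefficients are c. *)
Definition nevai_class c (b : R) : Prop := alpha c @ \oo --> b / 2.

Section Facts.
Variables (c : nat -> R) (P : nat -> {poly R}).
Hypothesis c01 : forall n, (0 < n)%N -> 0 < c n < 1.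
Hypothesis recP : three_term_recurrence c P.

Lemma size_recurrence n : size (P n) = n.+1.
Proof.
have [P0 P1 rec] := recP.
suff: size (P n) = n.+1 /\ size (P n.+1) = n.+2 by case.
elim: n => [|n [IH1 IH2]]; first by rewrite P0 P1 size_poly1 size_polyX.
split=> //; have := rec n.+1 isT; rewrite /acoef /= => /eqP.
have /andP[_ c1] := c01 (ltn0Sn n).
have a0 : 1 - c n.+1 != 0 by rewrite subr_eq0 gt_eqF.
rewrite -subr_eq => /eqP E; rewrite -(size_scale (P n.+2) a0) -E.
have nz : P n.+1 != 0 by rewrite -size_poly_eq0 IH2.
have sX : size ('X * P n.+1) = n.+3 by rewrite mulrC size_mulX // IH2.
rewrite size_polyDl ?sX // size_polyN.
by apply: leq_ltn_trans (size_scale_leq _ _) _; rewrite IH1 ltnS ltnW.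
Qed.

Lemma expansion_exists d (q : {poly R}) : (size q <= d)%N ->
  exists e : nat -> R, q = \sum_(k < d) e k *: P k.
Proof.
elim: d q => [|d IH] q.
  by rewrite leqn0 size_poly_eq0 => /eqP->; exists (fun=> 0); rewrite big_ord0.
move=> sq; have Pd : (P d)`_d != 0.
  have := lead_coef_eq0 (P d).
  by rewrite lead_coefE size_recurrence /= => ->; rewrite -size_poly_eq0 size_recurrence.
have [|e qe] := IH (q - (q`_d / (P d)`_d) *: P d).
  apply/leq_sizeP => j dj; rewrite coefB coefZ.
  have [<-|/negPf jd] := eqVneq d j; first by rewrite divfK // subrr.
  have dj' : (d < j)%N by rewrite ltn_neqAle jd.
  rewrite (leq_sizeP _ _ sq j dj') (leq_sizeP _ d.+1 _ j dj') ?size_recurrence //.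
  by rewrite mulr0 subr0.
exists (fun k => if k == d then q`_d / (P d)`_d else e k).
rewrite big_ord_recr /= eqxx; apply/eqP; rewrite -subr_eq qe.
by apply/eqP/eq_bigr => k _; rewrite ltn_eqF.
Qed.

Lemma expansion_unique d (e f : nat -> R) :
  \sum_(k < d) e k *: P k = \sum_(k < d) f k *: P k ->
  forall k, (k < d)%N -> e k = f k.
Proof.
elim: d => [//|d IH]; rewrite !big_ord_recr /= => E.
have low (u : nat -> R) : (\sum_(k < d) u k *: P k)`_d = 0.
  rewrite coef_sum big1 // => k _; rewrite coefZ.
  by rewrite (leq_sizeP _ k.+1 _ d) ?mulr0 ?size_recurrence.
have Pd : (P d)`_d != 0.
  have := lead_coef_eq0 (P d).
  by rewrite lead_coefE size_recurrence /= => ->; rewrite -size_poly_eq0 size_recurrence.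
have ed : e d = f d.
  have := congr1 (fun q : {poly R} => q`_d) E.
  by rewrite !coefD !low !coefZ !add0r => /(mulIf Pd).
move=> k; rewrite ltnS leq_eqVlt => /predU1P[->//|kd].
by apply: IH => //; move: E; rewrite ed => /addIr.
Qed.

Lemma linearization_coefs_exist : exists g, linearization_coefs P g.
Proof.
have ex m n : exists e : nat -> R,
    P m * P n = \sum_(k < (m + n).+1) e k *: P k.
  apply: expansion_exists; apply: leq_trans (size_polyMleq _ _) _.
  by rewrite !size_recurrence addSn addnS.
have [g gP] := choice (fun mn => ex mn.1 mn.2).
exists (fun m n k => if (k <= m + n)%N then g (m, n) k else 0) => m n; split.
  rewrite (gP (m, n)) /=; apply: eq_bigr => k _.
  by rewrite -ltnS ltn_ord.
by move=> k; rewrite ltnNge => /negPf->.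
Qed.

Lemma linearization_coefs_unique g g' :
  linearization_coefs P g -> linearization_coefs P g' -> g = g'.
Proof.
move=> gP gP'; apply/funext => m; apply/funext => n; apply/funext => k.
have [[E z] [E' z']] := (gP m n, gP' m n).
have [kmn|kmn] := leqP k (m + n); last by rewrite z // z'.
by apply: (@expansion_unique (m + n).+1); rewrite -?E -?E'.
Qed.

Lemma haar_integral g (mu : probability (measurableTypeR R) R) n :
  linearization_coefs P g -> orthogonalization_measure P mu ->
  (\int[mu]_x ((P n).[x] * (P n).[x])%:E)%E = ((haar g n)^-1)%:E.
Proof.
move=> gP om; have [P0 _ _] := recP; have [E _] := gP n n.
have iP k : mu.-integrable [set: measurableTypeR R] (fun x => (P k).[x]%:E).
  have [+ _] := om k 0%N; apply: eq_integrable => // x _.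
  by rewrite P0 hornerC mulr1.
rewrite invrK.
transitivity (\int[mu]_x (\sum_(k < (n + n).+1) (g n n k)%:E * (P k).[x]%:E))%E.
  apply: eq_integral => x _; rewrite -hornerM E horner_sum -sumEFin.
  by apply: eq_bigr => k _; rewrite hornerZ EFinM.
rewrite integral_sum //; last first.
  by move=> k; apply: integrableZl.
under eq_bigr => k _ do rewrite integralZl //.
have i0 k : (\int[mu]_x (P k).[x]%:E = (k == 0%N)%:R%:E)%E.
  have [->|k0] := eqVneq k 0%N.
    under eq_integral => x _ do rewrite P0 hornerC.
    rewrite integral_cst // mul1e; exact: probability_setT.
  have [_ [ik0 _]] := om k 0%N.
  have -> : (\int[mu]_x (P k).[x]%:E = \int[mu]_x ((P k).[x] * (P 0%N).[x])%:E)%E.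
    by apply: eq_integral => x _; rewrite P0 hornerC mulr1.
  by apply/eqP/negPn/negP => /ik0 /eqP; rewrite (negPf k0).
rewrite big_ord_recl i0 eqxx mule1 big1 ?adde0 // => k _.
by rewrite i0 mule0.
Qed.

End Facts.
End Defs.

(* Main.v *)
(** Write g_n = g(n,n;0) = 1/h(n).  On the open interval (-b,b) the orthonormal
    polynomials p_n = P_n / sqrt g_n grow subexponentially, because their
    recurrence tends to the constant-coefficient one whose characteristic roots
    have modulus 1; as g_n <= 1, so do the P_n.  Since P_k P_j is a convex
    combination of P_0, ..., P_(k+j), subexponential growth forces |P_k| <= 1 on
    (-b,b).

    Each P_n with n >= 1 has a zero in (-b,b).  For n odd take 0.  For n even,
    nonnegativity of g(2,N;N) gives c_1 <= alpha_(N+1)^2 + alpha_N^2, hence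
    c_1 <= b^2/2 in the limit, so that the zero sqrt c_1 of P_2 is smaller than
    b; by interlacing, the least positive zero of P_n is at most sqrt c_1.

    At such a zero x, 0 = P_n(x)^2 = g_n + sum_(k >= 1) g(n,n;k) P_k(x)
    >= g_n - (1 - g_n), i.e. g_n <= 1/2. *)

Require Import Defs.
From HB Require Import structures.
From mathcomp Require Import all_boot all_order all_algebra.
From mathcomp Require Import all_classical all_reals all_analysis.
From mathcomp Require Import polyrcf ring lra zify.

Import Order.TTheory GRing.Theory Num.Theory.
Import numFieldNormedType.Exports.

Local Open Scope classical_set_scope.
Local Open Scope ring_scope.

(** * General facts: first roots, perturbed recurrences, linearized sequences *)

(** [next_rootP] provides the least root in ]0, t[; if there is none, the intermediate value theorem
    forces [t] itself to be a root. *)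
Lemma exists_first_root (R : rcfType) (p : {poly R}) (t : R) :
  0 <= t -> 0 < p.[0] -> p.[t] <= 0 ->
  exists z, [/\ 0 < z <= t, p.[z] = 0 & forall y, 0 <= y < z -> 0 < p.[y]].
Proof.
move=> t0 p0 pt.
have p_neq0 : p != 0 by apply: contraTneq p0 => ->; rewrite horner0 ltxx.
have tpos : 0 < t.
  by rewrite lt_neqAle t0 andbT; apply: contraTneq pt => <-; rewrite -ltNge.
have pos z : {in `]0, z[, forall y, ~~ root p y} ->
    forall y, 0 <= y < z -> 0 < p.[y].
  move=> noz y /andP[y0 yz]; rewrite ltNge; apply/negP => py.
  have yn0 : y != 0 by apply: contraTneq py => ->; rewrite -ltNge.
  have ypos : 0 < y by rewrite lt_neqAle eq_sym yn0.
  have py' : p.[y] < 0.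
    rewrite lt_neqAle py andbT; have := noz y; rewrite in_itv /= ypos yz.
    by apply.
  have [|u] := @poly_ivtoo _ p 0 y y0; first by rewrite pmulr_rlt0.
  rewrite in_itv /= => /andP[u0 uy] /negP[].
  by apply/negP/noz; rewrite in_itv /= u0 (lt_trans uy).
have : forall z, {in `]0, z[, forall y, ~~ root p y} ->
    z = t -> p.[z] = 0.
  move=> z noz zt; apply/eqP; rewrite eq_le {1}zt pt /= leNgt; apply/negP => pz.
  have z0 : 0 <= z by rewrite zt.
  have [|u uin ur] := @poly_ivtoo _ p 0 z z0; first by rewrite pmulr_rlt0.
  by have := noz u uin; rewrite ur.
move=> zt; case: (next_rootP p 0 t) => [/eqP|z _ pz zin nor|z _ zE nor].
- by rewrite (negPf p_neq0).
- by exists z; move: zin; rewrite in_itv /= => /andP[-> /ltW ->]; split => //; apply: pos.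
- have {}zE : z = t by rewrite zE max_l.
  move: nor; rewrite -zE => nor; exists z; split; rewrite ?(zt z) ?lexx ?andbT //.
    by rewrite zE.
  exact: pos.
Qed.

(* The form u^2 - sigma u v + v^2 is conserved by the limiting recurrence and
   positive definite because |sigma| < 2; along the given recurrence it is
   therefore multiplied by factors tending to 1. *)
Lemma perturbed_recurrence_growth (R : realType) (s r p : nat -> R)
    (sigma rho : R) :
  `|sigma| < 2 -> s @ \oo --> sigma -> r @ \oo --> (1 : R) ->
  (forall n, p n.+2 = s n * p n.+1 - r n * p n) -> 1 < rho ->
  exists2 C, 0 <= C & forall n, `|p n| <= C * rho ^+ n.
Proof.
move=> sig2 cs cr rec rho1.
(* Coercivity constant of the quadratic form, from [2 |u v| <= u^2 + v^2]. *)
pose k : R := 1 - `|sigma| / 2.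
have k0 : 0 < k by rewrite /k; lra.
pose Q n := p n.+1 ^+ 2 - sigma * p n.+1 * p n + p n ^+ 2.
have coer n : k * (p n.+1 ^+ 2 + p n ^+ 2) <= Q n.
  rewrite /k /Q; set u := p n.+1; set v := p n.
  have h1 : `|sigma| * (2 * `|u * v|) <= `|sigma| * (u ^+ 2 + v ^+ 2).
    apply: ler_wpM2l => //; rewrite -subr_ge0.
    have [uv|uv] := ger0P (u * v).
      by have := sqr_ge0 (u - v); nra.
    by have := sqr_ge0 (u + v); nra.
  have h2 : sigma * (u * v) <= `|sigma| * `|u * v|.
    by rewrite -normrM ler_norm.
  lra.
(* If the three perturbation coefficients are below [d], the perturbation is at most
   [2 d (u^2 + v^2)], which coercivity bounds by [(rho^2 - 1) Q n]. *)
pose d : R := k * (rho ^+ 2 - 1) / 2.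
have rho0 : 0 < rho by lra.
have d0 : 0 < d.
  by rewrite /d; apply: divr_gt0 => //; apply: mulr_gt0 => //; nra.
(* The next three sequences are the coefficients of [u^2], [u v] and [v^2] in [Q n.+1 - Q n], where
   [u = p n.+1] and [v = p n]. *)
have cA : (s n * s n - sigma * s n) @[n --> \oo] --> 0.
  rewrite [X in _ --> X](_ : _ = sigma * sigma - sigma * sigma); last by ring.
  by apply: cvgB; apply: cvgM => //; apply: cvg_cst.
have cB : (sigma * r n + sigma - 2 * (s n * r n)) @[n --> \oo] --> 0.
  rewrite [X in _ --> X](_ : _ = sigma * 1 + sigma - 2 * (sigma * 1)); last by ring.
  apply: cvgB; last by apply: cvgM; [exact: cvg_cst|exact: cvgM].
  by apply: cvgD; [apply: cvgM => //; exact: cvg_cst|exact: cvg_cst].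
have cD : (r n * r n - 1) @[n --> \oo] --> 0.
  rewrite [X in _ --> X](_ : _ = 1 * 1 - 1); last by ring.
  by apply: cvgB; [exact: cvgM|exact: cvg_cst].
have [N _ step] : \forall n \near \oo, Q n.+1 <= rho ^+ 2 * Q n.
  near=> n.
  have lA : `|0 - (s n * s n - sigma * s n)| < d by near: n; move/cvgrPdist_lt: cA; apply.
  have lB : `|0 - (sigma * r n + sigma - 2 * (s n * r n))| < d.
    by near: n; move/cvgrPdist_lt: cB; apply.
  have lD : `|0 - (r n * r n - 1)| < d by near: n; move/cvgrPdist_lt: cD; apply.
  have := coer n; move: lA lB lD; rewrite /Q rec !sub0r !normrN.
  set u := p n.+1; set v := p n.
  set A := s n * s n - _; set B := sigma * r n + _ - _; set D := r n * r n - 1.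
  move=> lA lB lD co.
  have -> : (s n * u - r n * v) ^+ 2 - sigma * (s n * u - r n * v) * u + u ^+ 2
     = u ^+ 2 - sigma * u * v + v ^+ 2 + (A * u ^+ 2 + B * (u * v) + D * v ^+ 2).
    by rewrite /A /B /D; ring.
  have hA : A * u ^+ 2 <= d * u ^+ 2.
    by apply: ler_wpM2r; [exact: sqr_ge0|exact: le_trans (ler_norm _) (ltW lA)].
  have hD : D * v ^+ 2 <= d * v ^+ 2.
    by apply: ler_wpM2r; [exact: sqr_ge0|exact: le_trans (ler_norm _) (ltW lD)].
  have hB : B * (u * v) <= d * (u ^+ 2 + v ^+ 2).
    apply: le_trans (ler_norm _) _; rewrite normrM.
    apply: ler_pM => //; first exact: ltW.
    have [uv|uv] := ger0P (u * v).
      by have := sqr_ge0 (u - v); nra.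
    by have := sqr_ge0 (u + v); nra.
  have hd : d * (u ^+ 2 + v ^+ 2) * 2 <=
      (rho ^+ 2 - 1) * (u ^+ 2 - sigma * u * v + v ^+ 2).
    apply: le_trans (_ : (rho ^+ 2 - 1) * (k * (u ^+ 2 + v ^+ 2)) <= _).
      by rewrite /d; lra.
    by apply: ler_wpM2l => //; nra.
  lra.
have Q0 n : 0 <= Q n.
  apply: le_trans (coer n); apply: mulr_ge0; first exact: ltW.
  by apply: addr_ge0; exact: sqr_ge0.
have QN m : Q (N + m)%N <= Q N * (rho ^+ m) ^+ 2.
  elim: m => [|m IH]; first by rewrite addn0 expr0 expr1n mulr1.
  rewrite addnS; apply: le_trans (step _ _) _; first exact: leq_addr.
  rewrite (exprS _ m) exprMn mulrCA; apply: ler_wpM2l => //; exact: sqr_ge0.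
(* The square root handles the indices from [N] on; the sum absorbs the finitely many earlier
   ones. *)
exists (Num.sqrt (Q N / k) + \sum_(i < N) `|p i|).
  by rewrite addr_ge0 ?sqrtr_ge0 ?sumr_ge0.
have rhon n : 1 <= rho ^+ n by rewrite exprn_ege1 // ltW.
have S0 : 0 <= \sum_(i < N) `|p i| by rewrite sumr_ge0.
move=> n; have [nN|Nn] := ltnP n N.
  rewrite (bigD1 (Ordinal nN)) //=.
  set T := \sum_(i < N | _) _; have T0 : 0 <= T by rewrite sumr_ge0.
  have := sqrtr_ge0 (Q N / k); have := normr_ge0 (p n); have := rhon n.
  set S := Num.sqrt _; nra.
rewrite mulrDl; apply: ler_wpDr; first by rewrite mulr_ge0 // (le_trans ler01).
have rn0 : 0 <= rho ^+ n by rewrite (le_trans ler01).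
rewrite -sqrtr_sqr -[X in _ * X](ger0_norm rn0) -sqrtr_sqr -sqrtrM; last first.
  by rewrite divr_ge0 // ltW.
apply: ler_wsqrtr.
rewrite mulrAC ler_pdivlMr // mulrC.
apply: le_trans (_ : Q n <= _).
  apply: le_trans (coer n); rewrite ler_pM2l // lerDr; exact: sqr_ge0.
rewrite -(subnKC Nn); apply: le_trans (QN _) _.
apply: ler_wpM2l => //; rewrite lerXn2r ?nnegrE ?exprn_ge0 ?(ltW rho0) //.
by apply: ler_weXn2l; [exact: ltW|exact: leq_addl].
Unshelve. all: by end_near.
Qed.

(* Iterating [v k * v j = \sum_i g k j i * v i] bounds [`|v k| ^+ m] by
   [C * rho ^+ (k * m)] for all m. *)
Lemma linearized_le1 (R : realType) (g : nat -> nat -> nat -> R) (v : nat -> R) :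
  (forall m n k, 0 <= g m n k) ->
  (forall m n, \sum_(k < (m + n).+1) g m n k = 1) ->
  (forall m n, v m * v n = \sum_(k < (m + n).+1) g m n k * v k) ->
  v 0%N = 1 ->
  (forall rho, 1 < rho ->
     exists2 C, 0 <= C & forall n, `|v n| <= C * rho ^+ n) ->
  forall k, `|v k| <= 1.
Proof.
move=> g0 g1 gv v0 growth k.
have le_rho rho : 1 < rho -> `|v k| <= rho ^+ k.
  move=> rho1; have [C C0 Cv] := growth rho rho1.
  have rho0 : 0 < rho by lra.
  have iter m : forall j, `|v k| ^+ m * `|v j| <= C * (rho ^+ k) ^+ m * rho ^+ j.
    elim: m => [|m IH] j; first by rewrite !expr0 mul1r mulr1.
    rewrite exprSr -mulrA -normrM gv.
    apply: le_trans (_ : \sum_(i < (k + j).+1)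
        g k j i * (`|v k| ^+ m * `|v i|) <= _).
      rewrite mulrC; apply: le_trans (ler_wpM2r _ (ler_norm_sum _ _ _)) _.
        by rewrite exprn_ge0.
      rewrite mulr_suml; apply: ler_sum => i _.
      by rewrite normrM (ger0_norm (g0 _ _ _)) -mulrA [X in _ * X]mulrC.
    apply: le_trans (_ : \sum_(i < (k + j).+1)
        g k j i * (C * (rho ^+ k) ^+ m * rho ^+ (k + j)) <= _).
      apply: ler_sum => i _; apply: ler_wpM2l => //; apply: le_trans (IH i) _.
      apply: ler_wpM2l; first by rewrite mulr_ge0 // !exprn_ge0 // ltW.
      by apply: ler_weXn2l; [exact: ltW|rewrite -ltnS].
    by rewrite -mulr_suml g1 mul1r exprD exprSr !mulrA.
  rewrite leNgt; apply/negP => lt.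
  have rk0 : 0 < rho ^+ k by rewrite exprn_gt0.
  (* By [iter] at [j = 0] the powers of [q] stay below [C], whereas Bernoulli's inequality makes
     them unbounded as soon as [q > 1]. *)
  pose q := `|v k| / rho ^+ k.
  have q1 : 1 < q by rewrite /q ltr_pdivlMr // mul1r.
  have qC m : q ^+ m <= C.
    rewrite /q expr_div_n ler_pdivrMr ?exprn_gt0 //.
    by have := iter m 0%N; rewrite v0 normr1 expr0 !mulr1.
  have bern m : 1 + m%:R * (q - 1) <= q ^+ m.
    elim: m => [|m IH]; first by rewrite mul0r addr0 expr0.
    rewrite exprS -natr1.
    have : q * (1 + m%:R * (q - 1)) <= q * q ^+ m by apply: ler_wpM2l => //; lra.
    have : 0 <= m%:R * (q - 1) ^+ 2 by rewrite mulr_ge0 ?sqr_ge0 ?ler0n.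
    nra.
  pose m := Num.bound (C / (q - 1)).
  have : C / (q - 1) < m%:R.
    by apply: archi_boundP; rewrite divr_ge0 // subr_ge0 ltW.
  rewrite ltr_pdivrMr ?subr_gt0 // => Cm.
  by have := le_trans (bern m) (qC m); lra.
rewrite leNgt; apply/negP => v1.
(* With [rho = expR e], [rho ^+ k] is [|v k|] to the power [k / (k + 1)], hence smaller than
   [|v k|]; dividing by [k.+1] also covers [k = 0]. *)
pose e := ln `|v k| / k.+1%:R.
have e0 : 0 < e by rewrite divr_gt0 ?ln_gt0 ?ltr0Sn.
have := le_rho (expR e); rewrite expR_gt1 => /(_ e0).
rewrite -expRM_natl leNgt -[X in _ < X]lnK ?posrE ?(lt_trans ltr01) // ltr_expR.
rewrite /e mulrCA gtr_pMr ?ln_gt0 // ltr_pdivrMr ?ltr0Sn // mul1r ltr_nat ltnSn.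
by [].
Qed.

(** * Recurrences and linearization coefficients of the [P n] *)

Section JacobiPolynomials.
Variables (R : realType) (c : nat -> R) (P : nat -> {poly R}).
Variable (g : nat -> nat -> nat -> R).
Hypothesis c01 : forall n, (0 < n)%N -> 0 < c n < 1.
Hypothesis P_rec : three_term_recurrence c P.
Hypothesis g_lin : linearization_coefs P g.
Hypothesis g_ge0 : nonneg_linearization g.

Local Notation a := (acoef c).

Lemma acoef_gt0 n : 0 < a n.
Proof.
rewrite /acoef; case: n => [|n] /=; first exact: ltr01.
by rewrite subr_gt0; have /andP[] := c01 _ (ltn0Sn n).
Qed.

Lemma c_gt0 n : 0 < c n.+1.
Proof. by have /andP[] := c01 _ (ltn0Sn n). Qed.

Lemma mulX_recurrence n : 'X * P n.+1 = a n.+1 *: P n.+2 + c n.+1 *: P n.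
Proof. by have [_ _ /(_ n.+1 isT)] := P_rec. Qed.

Lemma horner_recurrence x n :
  x * (P n.+1).[x] = a n.+1 * (P n.+2).[x] + c n.+1 * (P n).[x].
Proof.
by have /(congr1 (horner^~ x)) := mulX_recurrence n; rewrite !hornerE.
Qed.

Lemma horner_at1 n : (P n).[1] = 1.
Proof.
have [P0 P1 _] := P_rec.
suff: (P n).[1] = 1 /\ (P n.+1).[1] = 1 by case.
elim: n => [|n [IH1 IH2]]; first by rewrite P0 P1 !hornerE.
split=> //; have := horner_recurrence 1 n; rewrite IH1 IH2 !mulr1.
have := acoef_gt0 n.+1; rewrite {1 2}/acoef /= => a0 h.
by apply: (mulfI (lt0r_neq0 a0)); lra.
Qed.

Lemma linearization_horner x m n :
  (P m).[x] * (P n).[x] = \sum_(k < (m + n).+1) g m n k * (P k).[x].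
Proof.
rewrite -hornerM (g_lin m n).1 horner_sum.
by apply: eq_bigr => k _; rewrite hornerZ.
Qed.

(** Evaluation at 1, where every [P k] is 1; with nonnegativity, products become convex
    combinations. *)
Lemma linearization_sum1 m n : \sum_(k < (m + n).+1) g m n k = 1.
Proof.
have := linearization_horner 1 m n; rewrite !horner_at1 mulr1 => ->.
by apply: eq_bigr => k _; rewrite horner_at1 mulr1.
Qed.

Lemma linearization_le1 m n : g m n 0 <= 1.
Proof.
rewrite -(linearization_sum1 m n) big_ord_recl lerDl.
by apply: sumr_ge0 => i _; exact: g_ge0.
Qed.

(** The two-step recurrence preserves the parity of the index. This form serves to compute products
    with [P 2]; the pointwise form below serves the interlacing of the even-index polynomials. *)
Lemma mulX2_recurrence n : 'X * ('X * P n.+2) =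
  (a n.+2 * a n.+3) *: P n.+4
  + (a n.+2 * c n.+3 + c n.+2 * a n.+1) *: P n.+2
  + (c n.+2 * c n.+1) *: P n.
Proof.
rewrite mulX_recurrence mulrDr -!scalerAr !mulX_recurrence !scalerDr !scalerA.
by rewrite -!addrA; congr (_ + _); rewrite !addrA -scalerDl.
Qed.

Lemma horner_recurrence2 x n : x ^+ 2 * (P n.+2).[x] =
  (a n.+2 * a n.+3) * (P n.+4).[x]
  + (a n.+2 * c n.+3 + c n.+2 * a n.+1) * (P n.+2).[x]
  + (c n.+2 * c n.+1) * (P n).[x].
Proof.
by rewrite expr2 -mulrA horner_recurrence mulrDr !(mulrCA x) !horner_recurrence; ring.
Qed.

(* The right-hand side minus [c 1] is [a 1 * g 2 N N] for [N = n + 2]: multiply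
   [P N] by [a 1 *: P 2 = 'X^2 - c 1]. *)
Lemma mulX2_diag_coef_ge n : c 1%N <= a n.+2 * c n.+3 + c n.+2 * a n.+1.
Proof.
have [P0 P1 _] := P_rec.
have P2 : a 1%N *: P 2%N = 'X * 'X - (c 1%N)%:P.
  have := mulX_recurrence 0; rewrite P0 P1 => ->.
  by rewrite alg_polyC addrK.
(* The coefficients of [('X^2 - c 1) * P n.+2] in the basis [P k]; uniqueness of expansions equates
   them with [a 1 * g 2 n.+2 k]. *)
pose f k := if k == n.+4 then a n.+2 * a n.+3 else
  if k == n.+2 then a n.+2 * c n.+3 + c n.+2 * a n.+1 - c 1%N else
  if k == n then c n.+2 * c n.+1 else 0.
have f0 k : k != n.+4 -> k != n.+2 -> k != n -> f k = 0.
  by rewrite /f => /negPf-> /negPf-> /negPf->.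
have fn4 : f n.+4 = a n.+2 * a n.+3 by rewrite /f eqxx.
have fn2 : f n.+2 = a n.+2 * c n.+3 + c n.+2 * a n.+1 - c 1%N.
  by rewrite /f ltn_eqF ?eqxx //; lia.
have fn : f n = c n.+2 * c n.+1 by rewrite /f eqxx !ltn_eqF //; lia.
have E : \sum_(k < n.+1.+4) (a 1%N * g 2%N n.+2 k) *: P k =
    \sum_(k < n.+1.+4) f k *: P k.
  transitivity (a 1%N *: (P 2%N * P n.+2)).
    rewrite (g_lin 2%N n.+2).1 scaler_sumr.
    by apply: eq_bigr => k _; rewrite scalerA.
  rewrite scalerAl P2 mulrBl -mulrA mulX2_recurrence mul_polyC.
  rewrite !big_ord_recr /= big1 => [|k _]; last first.
    have kn := ltn_ord k.
    by rewrite /f /= !ltn_eqF ?scale0r //; lia.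
  rewrite fn4 fn2 fn !f0 ?scale0r ?addr0 ?add0r; try by lia.
  by rewrite scalerBl [RHS]addrC [_ *: P n + _]addrC !addrA [RHS]addrAC.
have := @expansion_unique _ _ _ c01 P_rec _ (fun k => a 1%N * g 2%N n.+2 k) f E n.+2.
rewrite fn2 => h; rewrite -subr_ge0 -h; last by lia.
by rewrite mulr_ge0 ?g_ge0 // ltW ?acoef_gt0.
Qed.

(** * Zeros in the interval (-b, b) *)

Section Nevai.
Variable b : R.
Hypothesis b_gt0 : 0 < b.
Hypothesis c_nevai : nevai_class c b.

(** The right-hand side of [mulX2_diag_coef_ge] is [alpha c n.+3 ^+ 2 + alpha c n.+2 ^+ 2], whose
    limit is twice the square of [b / 2]. *)
Lemma c1_le_half : c 1%N <= b ^+ 2 / 2.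
Proof.
have cv : (alpha c n.+3 ^+ 2 + alpha c n.+2 ^+ 2) @[n --> \oo] --> b ^+ 2 / 2.
  rewrite [X in _ --> X](_ : _ = (b / 2) * (b / 2) + (b / 2) * (b / 2)); last first.
    by field.
  have cS j : alpha c (n + j)%N @[n --> \oo] --> b / 2.
    by rewrite (cvg_shiftn j (alpha c)).
  have c2 := cS 2%N; have c3 := cS 3%N.
  apply: cvgD.
    by under eq_fun do rewrite -addn3 expr2; exact: cvgM.
  by under eq_fun do rewrite -addn2 expr2; exact: cvgM.
apply: (cvgr_to_ge cv); near=> n.
have sq k : alpha c k.+1 ^+ 2 = c k.+1 * a k.
  by rewrite sqr_sqrtr // mulr_ge0 // ltW ?c_gt0 ?acoef_gt0.
by rewrite !sq [X in X + _]mulrC mulX2_diag_coef_ge.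
Unshelve. all: by end_near.
Qed.


(** The sign makes [F k] positive at 0, so that its least positive zero can be found by
    [exists_first_root]. *)
Let F k x := (-1) ^+ k * (P k.*2).[x].

(** At 0 the recurrence loses its left-hand side, so consecutive even-index values have opposite
    signs. *)
Lemma even_at0_gt0 k : 0 < F k 0.
Proof.
have [P0 _ _] := P_rec.
elim: k => [|k IH]; first by rewrite /F P0 hornerC mulr1.
have := horner_recurrence 0 k.*2; rewrite mul0r => h.
move: IH; rewrite /F doubleS exprS mulN1r.
set s := (-1) ^+ k; move=> IH.
rewrite -(pmulr_rgt0 _ (acoef_gt0 k.*2.+1)).
have : 0 < c k.*2.+1 * (s * (P k.*2).[0]) by rewrite mulr_gt0 ?c_gt0.
suff -> : acoef c k.*2.+1 * (- s * (P k.*2.+2).[0]) =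
  c k.*2.+1 * (s * (P k.*2).[0]) by [].
by have := congr1 ( *%R s) h; rewrite mulr0; lra.
Qed.

Lemma even_root k t : F k t <= 0 -> 0 <= t ->
  exists z, [/\ 0 < z <= t, F k z = 0 & forall y, 0 <= y < z -> 0 < F k y].
Proof.
move=> Ft t0.
have E y : ((-1) ^+ k *: P k.*2).[y] = F k y by rewrite hornerZ.
have [||z [zt z0 zp]] := exists_first_root _ ((-1) ^+ k *: P k.*2) t t0.
- by rewrite E even_at0_gt0.
- by rewrite E.
- exists z; split=> // [|y yz]; first by rewrite -E.
  by rewrite -E; exact: zp.
Qed.

(* At the first zero z of [F k.+1], the recurrence in steps of two makes
   [F k.+2 z] and [F k z] of opposite signs. *)
Lemma even_pos_pred k t : (forall y, 0 <= y <= t -> 0 < F k.+1 y) ->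
  forall y, 0 <= y <= t -> 0 < F k y.
Proof.
have [P0 _ _] := P_rec.
elim: k t => [|k IH] t Fpos y /andP[y0 yt].
  by rewrite /F P0 hornerC mulr1.
rewrite ltNge; apply/negP => Fy.
have [z [/andP[z0 zy] Fz Fzp]] := even_root _ _ Fy y0.
have Fk u : 0 <= u < z -> 0 < F k u.
  move=> /andP[u0 uz]; apply: (IH u) => [v /andP[v0 vu]|]; last by rewrite u0 /=.
  by apply: Fzp; rewrite v0 (le_lt_trans vu).
(* A negative value at [z] would place a zero of [F k] strictly before [z], against [Fk]. *)
have Fkz : 0 <= F k z.
  rewrite leNgt; apply/negP => Fkz.
  have [u [/andP[u0]]] := even_root _ _ (ltW Fkz) (ltW z0).
  rewrite le_eqVlt => /predU1P[->|uz] Fu _; first by rewrite Fu ltxx in Fkz.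
  by have := Fk u; rewrite Fu ltxx uz ltW // => /(_ isT).
have Fk2 : 0 < F k.+2 z by apply: Fpos; rewrite ltW //= (le_trans zy).
have h := horner_recurrence2 z k.*2.
have {}h : acoef c k.*2.+2 * acoef c k.*2.+3 * F k.+2 z +
    c k.*2.+2 * c k.*2.+1 * F k z = 0.
  move: Fz h; rewrite /F !doubleS !exprS; set s := (-1) ^+ k.
  set p := (P k.*2.+2).[z] => /eqP; rewrite mulN1r mulNr oppr_eq0 mulf_eq0.
  rewrite signr_eq0 /= => /eqP-> /eqP; rewrite !mulr0 addr0 eq_sym => /eqP h.
  by have := congr1 ( *%R s) h; rewrite mulr0 => <-; ring.
have : 0 < acoef c k.*2.+2 * acoef c k.*2.+3 * F k.+2 z.
  by apply: mulr_gt0 => //; apply: mulr_gt0; exact: acoef_gt0.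
have : 0 <= c k.*2.+2 * c k.*2.+1 * F k z.
  by apply: mulr_ge0 => //; apply: mulr_ge0; apply: ltW; exact: c_gt0.
lra.
Qed.

Lemma odd_at0 k : (P k.*2.+1).[0] = 0.
Proof.
have [_ P1 _] := P_rec.
elim: k => [|k IH]; first by rewrite P1 hornerX.
have := horner_recurrence 0 k.*2.+1; rewrite IH mul0r mulr0 addr0 => /esym/eqP.
by rewrite mulf_eq0 gt_eqF ?acoef_gt0 //= doubleS => /eqP.
Qed.

Lemma exists_root_in_nevai_interval n : (0 < n)%N ->
  exists2 x, `|x| < b & (P n).[x] = 0.
Proof.
have [P0 P1 _] := P_rec.
move=> n0; rewrite -(odd_double_half n); case on: (odd n).
  by exists 0; rewrite ?normr0 // add1n odd_at0.
have : (0 < n./2)%N by move: n0; rewrite -{1}(odd_double_half n) on; lia.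
case: n./2 => // k _; rewrite add0n.
pose w := Num.sqrt (c 1%N).
have w2 : w ^+ 2 = c 1%N by rewrite sqr_sqrtr // ltW // c_gt0.
have w0 : 0 <= w by exact: sqrtr_ge0.
have wb : w < b.
  rewrite ltNge; apply/negP => bw.
  have : b ^+ 2 <= c 1%N by rewrite -w2 lerXn2r ?nnegrE // ltW.
  by have := c1_le_half; have := exprn_gt0 2 b_gt0; lra.
have F1 : F 1 w = 0.
  have := horner_recurrence w 0; rewrite P0 P1 hornerX hornerC mulr1 -expr2 w2.
  move=> h; have /eqP : a 1%N * (P 2%N).[w] = 0 by lra.
  rewrite mulf_eq0.
  by rewrite gt_eqF ?acoef_gt0 //= => /eqP P2; rewrite /F /= P2 mulr0.
(* If [F k.+1] were positive on [0, w], descending with [even_pos_pred] would make [F 1] positive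
   there too, but [F 1] vanishes at [w]. *)
have [y] : exists y, ~ (0 <= y <= w -> 0 < F k.+1 y).
  apply/existsNP => Fpos.
  have : forall y, 0 <= y <= w -> 0 < F 1 y.
    by elim: k Fpos => // k IH Fpos; apply: IH; exact: even_pos_pred.
  by move=> /(_ w); rewrite w0 lexx F1 ltxx => /(_ isT).
move=> /not_implyP[/andP[y0 yw] /negP]; rewrite -leNgt => Fy.
have [z [/andP[z0 zy] Fz _]] := even_root _ _ Fy y0.
exists z; first by rewrite gtr0_norm // (le_lt_trans zy) // (le_lt_trans yw).
by move/eqP: Fz; rewrite mulf_eq0 signr_eq0 => /eqP.
Qed.

(** * Growth on (-b, b) and the bound on the squared norms [g n n 0] *)

Section Haar.
Hypothesis sqnorm_gt0 : forall n, 0 < g n n 0%N.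
Hypothesis sqnorm_rec : forall n, a n * g n.+1 n.+1 0%N = c n.+1 * g n n 0%N.

(* The recurrence of the orthonormal p_n = P_n / sqrt (g n n 0) has coefficients
   alpha_n; the bound passes to P_n because [g n n 0 <= 1]. *)
Lemma growth_in_nevai_interval x : `|x| < b -> forall rho, 1 < rho ->
  exists2 C, 0 <= C & forall n, `|(P n).[x]| <= C * rho ^+ n.
Proof.
move=> xb rho rho1.
pose N n := Num.sqrt (g n n 0%N).
have N0 n : 0 < N n by rewrite sqrtr_gt0.
have al0 n : 0 < alpha c n.+1.
  by rewrite sqrtr_gt0 mulr_gt0 ?c_gt0 ?acoef_gt0.
have ac n : 0 <= a n * c n.+1 by rewrite ltW // mulr_gt0 ?c_gt0 ?acoef_gt0.
have g0 n : 0 <= g n n 0%N by exact: ltW.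
(* After squaring, this identity and the next follow from [sqnorm_rec]; they replace [a] and [c] by
   [alpha] in the normalized recurrence. *)
have alN n : alpha c n.+1 * N n = a n * N n.+1.
  rewrite -[a n]ger0_norm ?ltW ?acoef_gt0 // -sqrtr_sqr -!sqrtrM ?sqr_ge0 //.
    by congr Num.sqrt; rewrite expr2 -mulrA sqnorm_rec /=; ring.
  by rewrite /= mulrC.
have alN' n : alpha c n.+1 * N n.+1 = c n.+1 * N n.
  rewrite -[X in X * N n]ger0_norm ?ltW ?c_gt0 // -sqrtr_sqr -!sqrtrM ?sqr_ge0 //.
    by congr Num.sqrt; rewrite expr2 -!mulrA -sqnorm_rec.
  by rewrite /= mulrC.
pose p n := (P n).[x] / N n.
have pE n : (P n).[x] = p n * N n by rewrite /p divfK // gt_eqF.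
have rec n : p n.+2 = (x / alpha c n.+2) * p n.+1
    - (alpha c n.+1 / alpha c n.+2) * p n.
  have := horner_recurrence x n; rewrite !pE mulrCA mulrA.
  rewrite [a _ * _]mulrCA -alN [c _ * _]mulrCA -alN' => h.
  have h' : x * p n.+1 = alpha c n.+2 * p n.+2 + alpha c n.+1 * p n.
    by apply: (mulIf (lt0r_neq0 (N0 n.+1))); lra.
  have := lt0r_neq0 (al0 n.+1); rewrite mulrAC h' => e; field.
  exact: e.
have cS j : alpha c (n + j)%N @[n --> \oo] --> b / 2.
  by rewrite (cvg_shiftn j (alpha c)).
have c1 := cS 1%N; have c2 := cS 2%N.
have b2 : b / 2 != 0 by rewrite gt_eqF // divr_gt0.
have [|||||C C0 pC] := perturbed_recurrence_growth _
  (fun n => x / alpha c n.+2) (fun n => alpha c n.+1 / alpha c n.+2) p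
  (x / (b / 2)) rho.
(* [|x| < b] is exactly the condition [|sigma| < 2] for [sigma = x / (b / 2)]. *)
- rewrite normf_div (gtr0_norm (_ : 0 < b / 2)) ?divr_gt0 //.
  by rewrite ltr_pdivrMr ?divr_gt0 // mulrC divfK ?pnatr_eq0.
- under eq_fun do rewrite -addn2.
  by apply: cvgM; [exact: cvg_cst|exact: cvgV].
- under eq_fun do rewrite -addn2 -addn1.
  by rewrite -(divff b2); apply: cvgM => //; exact: cvgV.
- exact: rec.
- exact: rho1.
- exists C => // n; rewrite pE normrM (gtr0_norm (N0 n)).
  apply: le_trans (pC n); rewrite ler_piMr //.
  rewrite -[leRHS]sqrtr1; apply: ler_wsqrtr; exact: linearization_le1.
Qed.

Lemma sqnorm_le_half n : (0 < n)%N -> g n n 0%N <= 1 / 2.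
Proof.
move=> n0; have [P0 _ _] := P_rec.
have [x xb Px] := exists_root_in_nevai_interval _ n0.
have P1 k : `|(P k).[x]| <= 1.
  apply: (linearized_le1 _ g (fun k => (P k).[x])) => //.
  - exact: linearization_sum1.
  - exact: linearization_horner.
  - by rewrite P0 hornerC.
  - exact: growth_in_nevai_interval.
have := linearization_horner x n n; have := linearization_sum1 n n.
rewrite Px mul0r !big_ord_recl P0 hornerC mulr1 => h1 h0.
suff : - (\sum_(i < n + n) g n n (lift ord0 i)) <=
    \sum_(i < n + n) g n n (lift ord0 i) * (P (lift ord0 i)).[x] by lra.
rewrite -sumrN; apply: ler_sum => i _.
rewrite -mulrN1 ler_wpM2l //.
by have := P1 (lift ord0 i); rewrite ler_norml => /andP[].
Qed.

End Haar.
End Nevai.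

(** * Squared norms as integrals against the orthogonalization measure *)

Section Measure.
Variable mu : probability (measurableTypeR R) R.
Hypothesis mu_orth : orthogonalization_measure P mu.

(** Orthogonality only makes the integral of [P n] squared nonzero; its sign is read off from the
    nonnegative coefficient [g n n 0] that equals it. *)
Lemma sqnorm_gt0 n : 0 < g n n 0%N.
Proof.
have [_ [_ /(_ erefl)]] := mu_orth n n.
by rewrite (haar_integral P_rec n g_lin mu_orth) /haar invrK lt_neqAle g_ge0 andbT
  eq_sym.
Qed.

Let J m n := (\int[mu]_x ((P m).[x] * (P n).[x]))%R.

(* Integrate x P_n P_(n+1), applying the recurrence to either factor. *)
Lemma sqnorm_recurrence n : a n * g n.+1 n.+1 0%N = c n.+1 * g n n 0%N.
Proof.
have Jnn k : J k k = g k k 0%N.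
  by rewrite /J /Rintegral (haar_integral P_rec k g_lin mu_orth) /= /haar invrK.
have Jmn k l : k <> l -> J k l = 0.
  have [_ [kl _]] := mu_orth k l.
  move=> ne; rewrite /J /Rintegral; case: eqP kl => [-> //|_ kl].
  by case: ne; exact: kl.
have int k l : mu.-integrable [set: measurableTypeR R]
    (EFin \o (fun x => (P k).[x] * (P l).[x])) by have [] := mu_orth k l.
have lin u v k l k' l' : (\int[mu]_x (u * ((P k).[x] * (P l).[x]) +
      v * ((P k').[x] * (P l').[x])))%R = u * J k l + v * J k' l'.
  have intZ w i j : mu.-integrable [set: measurableTypeR R]
      (EFin \o (fun x => w * ((P i).[x] * (P j).[x]))).
    exact: (integrableZl measurableT w (int i j)).
  by rewrite RintegralD // !RintegralZl.
(* A uniform form of the recurrence: for [n = 0] there is no lower term, so [d = 0] with a dummy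
   index [j = 0]. The bound on [j] makes [P j] orthogonal to [P n.+1]. *)
have [d [j [jn E]]] : exists d j, (j < n.+1)%N /\
    forall x, x * (P n).[x] = a n * (P n.+1).[x] + d * (P j).[x].
  have [P0 P1 _] := P_rec.
  case: n => [|n].
    exists 0, 0%N; split => // x.
    by rewrite P0 P1 hornerX hornerC mul0r addr0 mulr1 mul1r.
  by exists (c n.+1), n; split => [|x]; [lia|exact: horner_recurrence].
transitivity (\int[mu]_x (x * ((P n.+1).[x] * (P n).[x])))%R.
  rewrite -[LHS]addr0 -(mulr0 d) -(Jmn j n.+1); last by lia.
  rewrite -Jnn -lin; apply: eq_Rintegral => x _.
  by rewrite [RHS]mulrCA E; ring.
rewrite -[RHS]addr0 -(mulr0 (a n.+1)) -(Jmn n.+2 n); last by lia.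
rewrite -Jnn -lin; apply: eq_Rintegral => x _.
by rewrite [LHS]mulrA horner_recurrence; ring.
Qed.

End Measure.
End JacobiPolynomials.

Theorem corollary2p5 (R : realType) (c : nat -> R) (P : nat -> {poly R})
    (g : nat -> nat -> nat -> R)
    (mu : probability (measurableTypeR R) R) (b : R)
    (c_itv : forall n : nat, (0 < n)%N -> 0 < c n < 1)
    (P_rec : three_term_recurrence c P)
    (g_lin : linearization_coefs P g)
    (g_ge0 : nonneg_linearization g)
    (mu_orth : orthogonalization_measure P mu)
    (b_itv : 0 < b <= 1)
    (mu_nevai : nevai_class c b) :
  forall n : nat, (0 < n)%N -> 2 <= haar g n.
Proof.
move=> n n0; have /andP[b0 _] := b_itv.
have g0 := sqnorm_gt0 _ _ _ _ P_rec g_lin g_ge0 _ mu_orth.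
have grec := sqnorm_recurrence _ _ _ _ P_rec g_lin _ mu_orth.
have gle := sqnorm_le_half _ _ _ _ c_itv P_rec g_lin g_ge0 _ b0 mu_nevai g0 grec n n0.
rewrite /haar -[leLHS]invrK lef_pV2 ?posrE ?invr_gt0 //; lra.
Qed.
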